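(* Let $(U,\lesssim)$ be a quasiordered set. Then the following assertions are equivalent: (a) The Helly number of $(U,\lesssim)$ is $2$. (b) $\mathcal{B}(\approx)=\{{\uparrow}m\mid m \text{ is a minimal element of } (U,\lesssim)\}$. (c) $\mathcal{B}(\approx)$ is an irredundant covering of $U$ and $(U,\lesssim)$ is bounded by minimal elements.
   Context: A quasiorder is a reflexive and transitive binary relation. In a quasiordered set $(U,\lesssim)$, an element $x$ is minimal if $y\lesssim x$ implies $x\lesssim y$; $(U,\lesssim)$ is bounded by minimal elements if for every $x\in U$ there is a minimal $m\in U$ with $m\lesssim x$. Write ${\uparrow}x=\{y\in U\mid x\lesssim y\}$. The relation $\approx$ is the product ${\gtrsim}\circ{\lesssim}$: $x\approx y$ if and only if there is $a\in U$ with $a\lesssim x$ and $a\lesssim y$; it is a tolerance (a reflexive and symmetric relation) on $U$. For a tolerance $R$ on $U$, a nonempty $X\subseteq U$ is an $R$-preblock if $X\times X\subseteq R$; an $R$-block is an $R$-preblock maximal with respect to inclusion; $\mathcal{B}(R)$ is the set of all $R$-blocks. A covering of $U$ is a collection $\mathcal{H}$ of nonempty subsets of $U$ with $\bigcup\mathcal{H}=U$; it is irredundant if $\mathcal{H}\setminus\{X\}$ is not a covering of $U$ for any $X\in\mathcal{H}$. $(U,\lesssim)$ has Helly number $k$ if for every nonempty subset $A\subseteq U$: if any $k$ elements of $A$ have a common lower bound in $U$, then $A$ has a common lower bound in $U$ (no minimality of $k$ is required). In particular, the Helly number is $2$ if and only if every preblock of $\approx$ has a lower bound in $U$. *)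

(* Defs.v *)
From mathcomp Require Import all_boot.
From mathcomp Require Import classical_sets.
From Corelib Require Import RelationClasses.

Set Implicit Arguments.
Unset Strict Implicit.
Unset Printing Implicit Defensive.

Local Open Scope classical_set_scope.

Section Quasiorder.
Variables (U : Type) (le : U -> U -> Prop).

Definition minimal_elt (m : U) : Prop := forall y, le y m -> le m y.

Definition bounded_by_minimal : Prop :=
  forall x, exists2 m, minimal_elt m & le m x.

Definition up (x : U) : set U := [set y | le x y].

Definition approx (x y : U) : Prop := exists2 a, le a x & le a y.

Definition lower_bounds (A : set U) : set U := [set l | forall x, A x -> le l x].

(* "Any k elements of A" are given by a k-indexed family with values in A,
   repetitions allowed, so that a set A with fewer than k elements is not
   vacuously covered by the premise. *)
Definition has_helly_number (k : nat) : Prop :=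
  forall A : set U, A !=set0 ->
    (forall f : 'I_k -> U, (forall i, A (f i)) ->
       lower_bounds (range f) !=set0) ->
    lower_bounds A !=set0.

End Quasiorder.

Section Tolerance.
Variables (U : Type) (R : U -> U -> Prop).

Definition tolerance : Prop := Reflexive R /\ Symmetric R.

Definition preblock (X : set U) : Prop :=
  X !=set0 /\ (forall x y, X x -> X y -> R x y).

Definition block (X : set U) : Prop :=
  preblock X /\ (forall Y, preblock Y -> X `<=` Y -> Y = X).

Definition blocks : set (set U) := [set X | block X].

End Tolerance.

Section Covering.
Variable U : Type.

Definition covering (H : set (set U)) : Prop :=
  (forall X, H X -> X !=set0) /\ cover H id = [set: U].

Definition irredundant_covering (H : set (set U)) : Prop :=
  covering H /\ (forall X, H X -> ~ covering (H `\ X)).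

End Covering.

Lemma approx_tolerance (U : Type) (le : U -> U -> Prop) :
  PreOrder le -> tolerance (approx le).
Proof.
move=> [refl_le _]; split=> [x | x y [a ax ay]]; first by exists x.
by exists a.
Qed.

(* Main.v *)
Require Import Defs.
From mathcomp Require Import all_boot.
From mathcomp Require Import boolp classical_sets.
From Corelib Require Import RelationClasses.

(** Helly number 2 says exactly that every preblock of [approx le] has a lower
    bound ([helly2P]); since every preblock extends to a block by Zorn's lemma
    ([preblock_sub_block]), it is enough to bound the blocks
    ([helly2_of_bounded_blocks]).

    Each principal up-set is a preblock, its generator being a common lower
    bound of any two elements.  A block [X] with a lower bound [l] therefore
    lies in the preblock [up le l], so equals it, and maximality forces [l] to
    be minimal ([bounded_block]).  Under the Helly property this applies to all
    blocks, and conversely each [up le m] with [m] minimal is a block: a lower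
    bound of a larger preblock is below [m], hence equivalent to it
    ([up_minimal_block]).  This gives (a) <-> (b).

    In (b), blocks cover [U], so each element is above a minimal one; and the
    up-set of a minimal [m] is the only block containing [m], so no block can
    be dropped: this is (c).  In the other direction, irredundance gives each
    block [B] a private element [x], lying in no other block.  If [m] is minimal
    below [x], the block extending [up le m] contains [x] and so is [B];
    hence [m] belongs to [B], is related by [approx le] to all of [B], and a
    minimal element is below everything it is related to.  So [m] bounds [B]. *)

Local Open Scope classical_set_scope.

(** Zorn's lemma requires the family to be closed under the union of the empty
    chain, whereas preblocks are nonempty.  It is therefore applied to the sets
    [Z] for which [X `|` Z] has all its pairs in [R], a family containing the
    empty set. *)
Lemma preblock_sub_block (U : Type) (R : U -> U -> Prop) (X : set U) :
  preblock R X -> exists2 B, block R B & X `<=` B.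
Proof.
move=> [[x0 Xx0] RX].
pose P := [set Z : set U | forall x y, (X `|` Z) x -> (X `|` Z) y -> R x y].
have [F FP Ftot|Z [PZ Zmax]] := @Zorn_bigcup U P.
  move=> x y [Xx|[Y FY Yx]] [Xy|[Z FZ Zy]].
  - exact: RX.
  - by apply: (FP _ FZ); [left|right].
  - by apply: (FP _ FY); [right|left].
  - have [YZ|ZY] := Ftot _ _ FY FZ.
    + by apply: (FP _ FZ); right=> //; exact: YZ.
    + by apply: (FP _ FY); right=> //; exact: ZY.
exists (X `|` Z); last by move=> x Xx; left.
split; first by split=> //; exists x0; left.
move=> Y [_ RY] XZY; apply/seteqP; split=> // y Yy.
have PY : P Y by move=> u v Xu Xv; apply: RY; [case: Xu|case: Xv] => // w;
  apply: XZY; left.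
have ZY : Z `<=` Y by move=> z Zz; apply: XZY; right.
apply: contrapT => nXZy; apply: (Zmax Y) => //.
by split=> // YZ; apply: nXZy; right; exact: YZ.
Qed.

Lemma blocks_covering {U : Type} {R : U -> U -> Prop} :
  Reflexive R -> covering (blocks R).
Proof.
move=> Rrefl; split; first by move=> X [[]].
apply/seteqP; split=> // x _.
have [|B blB xB] := @preblock_sub_block U R [set x].
  by split; [exists x|move=> _ _ -> ->].
by exists B => //; exact: xB.
Qed.

(** If every point of [X] lay in another member of [H], the other
    members would still cover [U]. *)
Lemma irredundant_private {U : Type} {H : set (set U)} {X : set U} :
  irredundant_covering H -> H X ->
  exists2 x, X x & forall Y, H Y -> Y x -> Y = X.
Proof.
move=> [[Hne Hcov] Hirr] HX; apply: contrapT => noprivate.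
apply: (Hirr X HX); split; first by move=> Y [/Hne].
apply/seteqP; split=> // x _.
apply: contrapT => uncovered.
have only Y : H Y -> Y x -> Y = X.
  by move=> HY Yx; apply: contrapT => YX; apply: uncovered; exists Y.
have [Y HY Yx] : cover H id x by rewrite Hcov.
by apply: noprivate; exists x; rewrite // -(only Y HY Yx).
Qed.

Section QuasiorderLemmas.
Context {U : Type} {le : U -> U -> Prop} {le_preorder : PreOrder le}.

Lemma up_preblock (m : U) : preblock (approx le) (up le m).
Proof.
split; first by exists m; exact: PreOrder_Reflexive.
by move=> x y mx my; exists m.
Qed.

(** A common lower bound of [m] and [y] is equivalent to the minimal [m]. *)
Lemma minimal_approx (m y : U) : minimal_elt le m -> approx le m y -> le m y.
Proof.
move=> mmin [a am ay].
by apply: PreOrder_Transitive ay; exact: mmin.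
Qed.

Lemma bounded_block (X : set U) (l : U) :
  block (approx le) X -> lower_bounds le X l ->
  X = up le l /\ minimal_elt le l.
Proof.
move=> [_ Xmax] lX.
have Xup : up le l = X by apply: Xmax => //; exact: up_preblock.
split=> // y yl.
change (up le l y).
rewrite Xup -(Xmax (up le y) (up_preblock y)); first exact: PreOrder_Reflexive.
by move=> x /lX lx; exact: PreOrder_Transitive yl lx.
Qed.

(** A family indexed by ['I_2] may repeat a value, so the premise of the Helly
    property is the pairwise condition defining preblocks, with the pairs
    [(x, x)] included. *)
Lemma helly2P :
  has_helly_number le 2 <->
  forall A, preblock (approx le) A -> lower_bounds le A !=set0.
Proof.
split=> [helly A [A0 RA]|bounded A A0 RA].
  apply: helly => // f Af.
  have [a a0 a1] := RA _ _ (Af ord0) (Af ord_max).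
  exists a => _ [i _ <-].
  by have [->|->] : i = ord0 \/ i = ord_max;
    first by case: i => [[|[|//]] ?]; [left|right]; apply: val_inj.
apply: bounded; split=> // x y Ax Ay.
have [|a af] := RA (fun i : 'I_2 => if i == ord0 then x else y).
  by move=> i; case: ifP.
by exists a; apply: af; [exists ord0|exists ord_max].
Qed.

Lemma helly2_of_bounded_blocks :
  (forall B, block (approx le) B -> lower_bounds le B !=set0) ->
  has_helly_number le 2.
Proof.
move=> bounded; apply/helly2P => A /preblock_sub_block[B blB AB].
have [l lB] := bounded B blB.
by exists l => x /AB; exact: lB.
Qed.

Lemma up_minimal_block (m : U) :
  has_helly_number le 2 -> minimal_elt le m -> block (approx le) (up le m).
Proof.
move=> /helly2P bounded mmin; split; first exact: up_preblock.
move=> Y /bounded[l lY] mY; apply/seteqP; split=> // y /lY ly.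
apply: PreOrder_Transitive ly; apply: mmin; apply: lY; apply: mY.
exact: PreOrder_Reflexive.
Qed.

Lemma helly2_iff_blocks_up :
  has_helly_number le 2 <->
  blocks (approx le) = [set up le m | m in [set m | minimal_elt le m]].
Proof.
split=> [helly|blocksE].
  apply/seteqP; split=> [X blX|_ [m mmin <-]]; last exact: up_minimal_block.
  have [l lX] := helly2P.1 helly X blX.1.
  by have [-> lmin] := bounded_block _ _ blX lX; exists l.
apply: helly2_of_bounded_blocks => B blB.
have : blocks (approx le) B by [].
by rewrite blocksE => -[m _ <-]; exists m.
Qed.

Lemma blocks_up_irredundant_bounded :
  blocks (approx le) = [set up le m | m in [set m | minimal_elt le m]] ->
  irredundant_covering (blocks (approx le)) /\ bounded_by_minimal le.
Proof.
move=> blocksE.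
have cov := blocks_covering (approx_tolerance le_preorder).1.
rewrite blocksE in cov *; split; last first.
  move=> x; have : [set: U] x by [].
  by rewrite -cov.2 => -[_ [m mmin <-] mx]; exists m.
split=> // _ [m mmin <-] [_ cov'].
have : [set: U] m by [].
rewrite -cov' => -[_ [[m' m'min <-] neq] m'm].
apply: neq; apply/seteqP; split=> y; apply: PreOrder_Transitive => //.
exact: mmin.
Qed.

Lemma irredundant_bounded_helly2 :
  irredundant_covering (blocks (approx le)) -> bounded_by_minimal le ->
  has_helly_number le 2.
Proof.
move=> irr bdd; apply: helly2_of_bounded_blocks => B blB.
have [x Bx private] := irredundant_private irr blB.
have [m mmin mx] := bdd x.
have Bm : B m.
  have [C blC mC] := preblock_sub_block _ _ _ (up_preblock m).
  rewrite -(private C blC (mC x mx)).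
  by apply: mC; exact: PreOrder_Reflexive.
exists m => y By; apply: minimal_approx => //.
exact: blB.1.2.
Qed.

End QuasiorderLemmas.

Theorem theorem4p1 (U : Type) (le : U -> U -> Prop) (le_preorder : PreOrder le) :
  (has_helly_number le 2 <->
     blocks (approx le) = [set up le m | m in [set m | minimal_elt le m]]) /\
  (has_helly_number le 2 <->
     irredundant_covering (blocks (approx le)) /\ bounded_by_minimal le).
Proof.
split; first exact: helly2_iff_blocks_up.
split=> [/helly2_iff_blocks_up|[irr bdd]].
  exact: blocks_up_irredundant_bounded.
exact: irredundant_bounded_helly2.
Qed.
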